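(* Let $\mathbb{F}\in\{\mathbb{R},\mathbb{C}\}$, $q\ge2$, and let $\mathscr{O}=\{O_i\}_{i=1}^n$ be an $\alpha$-unitary design of self-adjoint $q\times q$ matrices over $\mathbb{F}$ with $\alpha>0$. Then the least-squares estimator is $$\hat\rho^{\mathrm{LSE}}=\frac{\mathfrak{D}^*P}{n\alpha}-\frac{1-\alpha}{\alpha}\frac{I_q}{q},\qquad\text{where}\quad \mathfrak{D}^*P=\sum_{i=1}^n\sum_{k=1}^{q_i}\frac{p_{ik}}{m_{ik}}\Pi_{ik}.$$ If the design consists exclusively of rank-one projections ($m_{ik}=1$ for all $i,k$), then $\alpha=\alpha_{\mathcal{Q}}$, where $\alpha_{\mathcal{Q}}=(q/2+1)^{-1}$ if $\mathbb{F}=\mathbb{R}$ and $\alpha_{\mathcal{Q}}=(q+1)^{-1}$ if $\mathbb{F}=\mathbb{C}$, and for any density matrix $\rho$ the mean-squared error is $$\mathbb{E}\big[\|\rho-\hat\rho^{\mathrm{LSE}}\|_2^2\,\big|\,\rho\big]=\frac1{nr\alpha_{\mathcal{Q}}^2}\Big[\Big(1-\frac1q\Big)-\alpha_{\mathcal{Q}}\Big(\mathrm{Tr}[\rho^2]-\frac1q\Big)\Big].$$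
   Context: $\mathbb{F}^{q\times q}_{sa}$ is the real vector space of self-adjoint (symmetric/Hermitian) $q\times q$ matrices with Frobenius inner product and norm $\|\cdot\|_2$. A density matrix is a non-negative definite trace-one element of it. Each $O_i=\sum_{k=1}^{q_i}\lambda_{ik}\Pi_{ik}$ (distinct eigenvalues, orthogonal eigenprojections, $m_{ik}=\mathrm{Tr}[\Pi_{ik}]$, $q_i\ge2$). The index map is $k_i(\ell)=k$ iff $\sum_{k'<k}m_{ik'}<\ell\le\sum_{k'\le k}m_{ik'}$, $1\le\ell\le q$. The design tensor $\mathfrak{D}:\mathbb{F}^{q\times q}_{sa}\to\mathbb{R}^{n\times q}$ is $(\mathfrak{D}[S])_{i\ell}=\mathrm{Tr}[S\Pi_{i\,k_i(\ell)}]/m_{i\,k_i(\ell)}$; then $\frac{\mathfrak{D}^*\mathfrak{D}}{n}S=\frac1n\sum_{i,k}\frac{\mathrm{Tr}[S\Pi_{ik}]}{m_{ik}}\Pi_{ik}$. $\mathscr{O}$ is an $\alpha$-unitary design if $\frac{\mathfrak{D}^*\mathfrak{D}}{n}\Delta=\alpha\Delta$ for every traceless $\Delta\in\mathbb{F}^{q\times q}_{sa}$. Data: given the density matrix $\rho$, the outcomes $Y_{ij}$ ($1\le i\le n$, $1\le j\le r$) are independent with $\mathbb{P}(Y_{ij}=\lambda_{ik}\mid\rho)=\mathrm{Tr}[\rho\Pi_{ik}]$; $p_{ik}=\#\{j:Y_{ij}=\lambda_{ik}\}/r$, and the data matrix $P\in\mathbb{R}^{n\times q}$ has entries $P_{i\ell}=p_{i\,k_i(\ell)}/m_{i\,k_i(\ell)}$.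 $\hat\rho^{\mathrm{LSE}}$ is the (unique, for $\alpha>0$) minimizer of $\|\mathfrak{D}[S]-P\|_2^2$ over trace-one $S\in\mathbb{F}^{q\times q}_{sa}$, equal to $(\mathfrak{D}^*\mathfrak{D})^{-1}\mathfrak{D}^*P$. *)

(* Defs.v *)
From HB Require Import structures.
From mathcomp Require Import all_boot all_order all_algebra.
From mathcomp Require Import complex.
From mathcomp Require Import all_classical all_reals all_analysis.

Set Implicit Arguments.
Unset Strict Implicit.
Unset Printing Implicit Defensive.

Import Order.TTheory GRing.Theory Num.Theory.
Import numFieldNormedType.Exports.

Local Open Scope classical_set_scope.
Local Open Scope ring_scope.

Inductive base_field := RealField | ComplexField.

Definition carrier (R : realType) (F : base_field) : numFieldType :=
  match F with RealField => R | ComplexField => R[i] end.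

Definition sconj (R : realType) (F : base_field) : carrier R F -> carrier R F :=
  match F with RealField => fun x => x | ComplexField => fun z => conjc z end.

Definition sRe (R : realType) (F : base_field) : carrier R F -> R :=
  match F with RealField => fun x => x | ComplexField => fun z => complex.Re z end.

Definition of_real (R : realType) (F : base_field) : R -> carrier R F :=
  match F with RealField => fun x => x | ComplexField => fun x => real_complex R x end.

Section Matrices.
Context {R : realType} {F : base_field}.

(* Conjugate transpose (plain transpose when F = RealField). *)
Definition adjmx m p (A : 'M[carrier R F]_(m, p)) : 'M[carrier R F]_(p, m) :=
  map_mx (@sconj R F) A^T.

Definition rscale m p (a : R) (A : 'M[carrier R F]_(m, p)) : 'M[carrier R F]_(m, p) :=
  of_real F a *: A.

Definition selfadjoint q (S : 'M[carrier R F]_q) : Prop := adjmx S = S.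

(* Only applied where the trace is a real number (self-adjoint matrices and
   products of two of them), so that taking the real part loses nothing. *)
Definition rtr q (S : 'M[carrier R F]_q) : R := sRe (\tr S).

(* On self-adjoint matrices this is Tr[S T]. *)
Definition frob q (S T : 'M[carrier R F]_q) : R := rtr (S *m adjmx T).

Definition frob_norm2 q (S : 'M[carrier R F]_q) : R := frob S S.

Definition density_matrix q (rho : 'M[carrier R F]_q) : Prop :=
  [/\ selfadjoint rho,
      forall x : 'cV[carrier R F]_q, 0 <= rtr (adjmx x *m rho *m x)
    & \tr rho = 1].

(* Spectral decomposition of O: distinct real eigenvalues, and nonzero
   orthogonal eigenprojections that are mutually orthogonal and sum to the
   identity. It is determined by O up to the numbering of the eigenvalues. *)
Record spectral_decomposition q (O : 'M[carrier R F]_q) := SpectralDecomposition {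
  neig : nat;
  neig_ge2 : (1 < neig)%N;
  eigval : 'I_neig -> R;
  eigproj : 'I_neig -> 'M[carrier R F]_q;
  eigval_inj : injective eigval;
  eigproj_neq0 : forall k, eigproj k != 0;
  eigproj_sa : forall k, selfadjoint (eigproj k);
  eigproj_idem : forall k, eigproj k *m eigproj k = eigproj k;
  eigproj_orth : forall k l, k != l -> eigproj k *m eigproj l = 0;
  eigproj_sum : \sum_k eigproj k = 1%:M;
  spectral_sum : O = \sum_k rscale (eigval k) (eigproj k)
}.

End Matrices.

Section Design.
Context {R : realType} {F : base_field} {n q : nat}.
Context {O : 'I_n -> 'M[carrier R F]_q}.
Variable sd : forall i, spectral_decomposition (O i).

Definition mult (i : 'I_n) (k : 'I_(neig (sd i))) : R := rtr (eigproj k).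

Definition eig0 (i : 'I_n) : 'I_(neig (sd i)) := Ordinal (ltnW (neig_ge2 (sd i))).

(* The map k_i. As l : 'I_q is numbered from 0, l.+1 stands for the 1-based
   index. There is exactly one such k, so the default eig0 is never used. *)
Definition eigidx (i : 'I_n) (l : 'I_q) : 'I_(neig (sd i)) :=
  odflt (eig0 i)
    [pick k : 'I_(neig (sd i)) |
        (\sum_(k' < neig (sd i) | (k' < k)%N) mult k' < l.+1%:R)
     && (l.+1%:R <= \sum_(k' < neig (sd i) | (k' <= k)%N) mult k')].

Definition design_tensor (S : 'M[carrier R F]_q) : 'M[R]_(n, q) :=
  \matrix_(i, l) (rtr (S *m eigproj (eigidx i l)) / mult (eigidx i l)).

Definition rfrob (A B : 'M[R]_(n, q)) : R := \sum_i \sum_l A i l * B i l.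

(* The adjoint of the design tensor, as an operator from the real n x q
   matrices to the self-adjoint q x q matrices, both with the Frobenius inner
   product. *)
Definition design_adjoint (A : 'M[R]_(n, q)) : 'M[carrier R F]_q :=
  xget 0 [set T | selfadjoint T /\
    forall S, selfadjoint S -> frob T S = rfrob A (design_tensor S)].

Definition unitary_design (alpha : R) : Prop :=
  forall Delta : 'M[carrier R F]_q, selfadjoint Delta -> \tr Delta = 0 ->
    rscale n%:R^-1 (design_adjoint (design_tensor Delta)) = rscale alpha Delta.

Section Data.
Context {r : nat}.
Variable y : 'I_n -> 'I_r -> R.

Definition possible_data : Prop :=
  forall i j, exists k : 'I_(neig (sd i)), y i j = eigval k.

Definition freq (i : 'I_n) (k : 'I_(neig (sd i))) : R :=
  #|[set j : 'I_r | y i j == eigval k]%SET|%:R / r%:R.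

Definition data_matrix : 'M[R]_(n, q) :=
  \matrix_(i, l) (freq (eigidx i l) / mult (eigidx i l)).

End Data.

Definition is_lse (A : 'M[R]_(n, q)) (S : 'M[carrier R F]_q) : Prop :=
  [/\ selfadjoint S, \tr S = 1 &
      forall T : 'M[carrier R F]_q, selfadjoint T -> \tr T = 1 ->
        rfrob (design_tensor S - A) (design_tensor S - A)
          <= rfrob (design_tensor T - A) (design_tensor T - A)].

Definition rho_lse (A : 'M[R]_(n, q)) : 'M[carrier R F]_q :=
  xget 0 [set S | is_lse A S].

End Design.

Definition mutually_independent (d : measure_display) (Om : measurableType d)
    (R : realType) (Pr : probability Om R) (I : finType) (X : I -> {RV Pr >-> R}) :
    Prop :=
  forall (J : {set I}) (B : I -> set R), (forall i, measurable (B i)) ->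
    Pr [set w | forall i, i \in J -> B i (X i w)]
      = (\prod_(i in J) Pr (X i @^-1` B i))%E.

(* The law of the measurement outcomes given the state rho: independent, and
   Y i j is equal to the k-th eigenvalue of O i with probability Tr[rho Pi_ik]. *)
Definition outcomes (R : realType) (F : base_field) (n q : nat)
    (O : 'I_n -> 'M[carrier R F]_q) (sd : forall i, spectral_decomposition (O i))
    (rho : 'M[carrier R F]_q) (r : nat) (d : measure_display)
    (Om : measurableType d) (Pr : probability Om R)
    (Y : 'I_n -> 'I_r -> {RV Pr >-> R}) : Prop :=
  mutually_independent (fun ij : 'I_n * 'I_r => Y ij.1 ij.2) /\
  forall i j (k : 'I_(neig (sd i))),
    Pr (Y i j @^-1` [set eigval k]) = (rtr (rho *m eigproj k))%:E.

Definition alphaQ (R : realType) (F : base_field) (q : nat) : R :=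
  match F with
  | RealField => (q%:R / 2%:R + 1)^-1
  | ComplexField => (q%:R + 1)^-1
  end.

(* Main.v *)
(* For every data matrix A, not only for genuine data, the least-squares problem
   has the unique solution I/q + (D^*A - (Tr[D^*A]/q) I) / (n alpha), because
   D^*D acts as n alpha on traceless matrices and as n on I, so that the gradient
   there is a multiple of I.  For data, Tr[D^*P] = n.
   For rank-one designs, sum_ik Tr[S Pi_ik]^2 is the quadratic form of D^*D.
   Evaluating it on the matrix units E_aa and on u E_ab + u^* E_ba and summing up
   gives sum_ik |Pi_ik|^2, which is n q: this is an equation for alpha.
   Finally rho is its own estimator at D[rho], so the squared error is a quadratic
   form in the centered indicators 1(Y_ij = lambda_ik) - Tr[rho Pi_ik], and its
   mean involves only their covariances; since the estimator formula holds for all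
   data, outcomes outside the spectrum need no separate treatment. *)
Require Import Defs.
From HB Require Import structures.
From mathcomp Require Import all_boot all_order all_algebra.
From mathcomp Require Import complex ring lra zify.
From mathcomp Require Import all_classical all_reals all_analysis.

Set Implicit Arguments.
Unset Strict Implicit.
Unset Printing Implicit Defensive.

Import Order.TTheory GRing.Theory Num.Theory.
Import numFieldNormedType.Exports.

Local Open Scope classical_set_scope.
Local Open Scope ring_scope.

(** * Conjugation, real part and real embedding as morphisms, uniformly in the field *)

Section Scalars.
Context {R : realType} {F : base_field}.

Let sconj_zmod : zmod_morphism (@sconj R F).
Proof. by case: F => // x y; rewrite /sconj rmorphB. Qed.

Let sconj_monoid : monoid_morphism (@sconj R F).
Proof.
by case: F; split=> // [|x y]; rewrite /sconj ?rmorph1 ?rmorphM.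
Qed.

HB.instance Definition _ :=
  GRing.isZmodMorphism.Build _ _ (@sconj R F) sconj_zmod.
HB.instance Definition _ :=
  GRing.isMonoidMorphism.Build _ _ (@sconj R F) sconj_monoid.

Let of_real_zmod : zmod_morphism (@of_real R F).
Proof. by case: F => // x y; rewrite /of_real rmorphB. Qed.

Let of_real_monoid : monoid_morphism (@of_real R F).
Proof. by case: F; split=> // x y; rewrite /of_real rmorphM. Qed.

HB.instance Definition _ :=
  GRing.isZmodMorphism.Build _ _ (@of_real R F) of_real_zmod.
HB.instance Definition _ :=
  GRing.isMonoidMorphism.Build _ _ (@of_real R F) of_real_monoid.

Let sRe_zmod : zmod_morphism (@sRe R F).
Proof. by case: F => // x y; rewrite /sRe raddfB. Qed.

HB.instance Definition _ :=
  GRing.isZmodMorphism.Build _ _ (@sRe R F) sRe_zmod.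

Lemma sconjK : involutive (@sconj R F).
Proof. by case: F => // z; exact: conjcK. Qed.

Lemma sconj_of_real (a : R) : sconj (of_real F a) = of_real F a.
Proof. by case: F => //=; rewrite oppr0. Qed.

Lemma sRe_of_real (a : R) : sRe (of_real F a) = a.
Proof. by case: F. Qed.

Lemma sRe_of_realM (a : R) (z : carrier R F) :
  sRe (of_real F a * z) = a * sRe z.
Proof. by case: F z => // -[x y] /=; rewrite mul0r subr0. Qed.

Lemma sRe_conj (z : carrier R F) : sRe (sconj z) = sRe z.
Proof. by case: F z => // -[]. Qed.

Lemma sconj_fixed (z : carrier R F) : sconj z = z -> z = of_real F (sRe z).
Proof.
case: F z => // -[x y] /= [] yN; congr Complex; lra.
Qed.

Lemma sRe_normsq_ge0 (z : carrier R F) : 0 <= sRe (z * sconj z).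
Proof.
by case: F z => [x|[x y]] /=; nra.
Qed.

Lemma sRe_normsq_eq0 (z : carrier R F) : sRe (z * sconj z) = 0 -> z = 0.
Proof.
case: F z => [x|[x y]] /=; first by move=> /eqP; rewrite mulf_eq0 orbb => /eqP.
rewrite mulrN opprK -!expr2 => h; congr Complex; nra.
Qed.

End Scalars.

(** * Traces, self-adjoint matrices and the Frobenius inner product *)

Section HilbertSchmidt.
Context {R : realType} {F : base_field}.
Implicit Types a b : R.
Local Notation K := (carrier R F).

Lemma adjmxD m p (A B : 'M[K]_(m, p)) : adjmx (A + B) = adjmx A + adjmx B.
Proof. by rewrite /adjmx linearD map_mxD. Qed.

Lemma adjmxM m p s (A : 'M[K]_(m, p)) (B : 'M[K]_(p, s)) :
  adjmx (A *m B) = adjmx B *m adjmx A.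
Proof. by rewrite /adjmx trmx_mul map_mxM. Qed.

Lemma adjmxZ m p (c : K) (A : 'M[K]_(m, p)) :
  adjmx (c *: A) = sconj c *: adjmx A.
Proof. by rewrite /adjmx linearZ map_mxZ. Qed.

Lemma adjmx_rscale m p a (A : 'M[K]_(m, p)) :
  adjmx (rscale a A) = rscale a (adjmx A).
Proof. by rewrite /rscale adjmxZ sconj_of_real. Qed.

Lemma adjmx_scalar q (c : K) : adjmx (c%:M : 'M[K]_q) = (sconj c)%:M.
Proof. by rewrite /adjmx tr_scalar_mx map_scalar_mx. Qed.

Lemma trace_adjmx q (A : 'M[K]_q) : \tr (adjmx A) = sconj (\tr A).
Proof.
by rewrite /mxtrace rmorph_sum; apply: eq_bigr => i _; rewrite !mxE.
Qed.

Lemma rtr_zmod q : zmod_morphism (@rtr R F q).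
Proof. by move=> A B; rewrite /rtr !raddfB. Qed.

HB.instance Definition _ q :=
  GRing.isZmodMorphism.Build _ _ (@rtr R F q) (@rtr_zmod q).

Lemma rscale_zmod m p a : zmod_morphism (@rscale R F m p a).
Proof. by move=> A B; rewrite /rscale scalerBr. Qed.

HB.instance Definition _ m p a :=
  GRing.isZmodMorphism.Build _ _ (@rscale R F m p a) (@rscale_zmod m p a).

Lemma rscale1 m p (A : 'M[K]_(m, p)) : rscale 1 A = A.
Proof. by rewrite /rscale rmorph1 scale1r. Qed.

Lemma rscale0 m p (A : 'M[K]_(m, p)) : rscale 0 A = 0.
Proof. by rewrite /rscale rmorph0 scale0r. Qed.

Lemma rscalerA m p a b (A : 'M[K]_(m, p)) :
  rscale a (rscale b A) = rscale (a * b) A.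
Proof. by rewrite /rscale scalerA rmorphM. Qed.

Lemma rscaleDl m p a b (A : 'M[K]_(m, p)) :
  rscale (a + b) A = rscale a A + rscale b A.
Proof. by rewrite /rscale rmorphD scalerDl. Qed.

Lemma rscaleBl m p a b (A : 'M[K]_(m, p)) :
  rscale (a - b) A = rscale a A - rscale b A.
Proof. by rewrite /rscale rmorphB scalerBl. Qed.

Lemma rscale_nat m p k (A : 'M[K]_(m, p)) : rscale k%:R A = A *+ k.
Proof. by rewrite /rscale rmorph_nat scaler_nat. Qed.

Lemma rscale_suml m p (I : Type) (s : seq I) (P : pred I) (c : I -> R)
    (A : 'M[K]_(m, p)) :
  \sum_(i <- s | P i) rscale (c i) A = rscale (\sum_(i <- s | P i) c i) A.
Proof. by rewrite /rscale rmorph_sum scaler_suml. Qed.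

Lemma rtr_rscale q a (A : 'M[K]_q) : rtr (rscale a A) = a * rtr A.
Proof. by rewrite /rtr /rscale mxtraceZ sRe_of_realM. Qed.

Lemma rtr1 q : rtr (1%:M : 'M[K]_q) = q%:R.
Proof. by rewrite /rtr mxtrace1 -(rmorph_nat (@of_real R F)) sRe_of_real. Qed.

Lemma rtr_adjmx q (A : 'M[K]_q) : rtr (adjmx A) = rtr A.
Proof. by rewrite /rtr trace_adjmx sRe_conj. Qed.

Lemma trace_sa q (A : 'M[K]_q) : selfadjoint A -> \tr A = of_real F (rtr A).
Proof. by move=> sA; apply: sconj_fixed; rewrite -trace_adjmx sA. Qed.

Lemma sa0 q : selfadjoint (0 : 'M[K]_q).
Proof. by rewrite /selfadjoint /adjmx linear0 map_mx0. Qed.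

Lemma saD q (A B : 'M[K]_q) :
  selfadjoint A -> selfadjoint B -> selfadjoint (A + B).
Proof. by rewrite /selfadjoint adjmxD => -> ->. Qed.

Lemma saZ q a (A : 'M[K]_q) : selfadjoint A -> selfadjoint (rscale a A).
Proof. by rewrite /selfadjoint adjmx_rscale => ->. Qed.

Lemma rscaleN1 m p (A : 'M[K]_(m, p)) : rscale (-1) A = - A.
Proof. by rewrite /rscale rmorphN1 scaleN1r. Qed.

Lemma saB q (A B : 'M[K]_q) :
  selfadjoint A -> selfadjoint B -> selfadjoint (A - B).
Proof. by move=> sA sB; rewrite -rscaleN1; apply/saD/saZ. Qed.

Lemma sa1 q : selfadjoint (1%:M : 'M[K]_q).
Proof. by rewrite /selfadjoint adjmx_scalar rmorph1. Qed.

Lemma sa_sum q (I : Type) (s : seq I) (P : pred I) (A : I -> 'M[K]_q) :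
  (forall i, selfadjoint (A i)) -> selfadjoint (\sum_(i <- s | P i) A i).
Proof. by move=> sA; apply: big_ind => //; [exact: sa0|exact: saD]. Qed.

Lemma frobC q (A B : 'M[K]_q) : frob A B = frob B A.
Proof.
rewrite /frob -rtr_adjmx adjmxM; congr (rtr (_ *m _)).
by apply/matrixP => i j; rewrite !mxE sconjK.
Qed.

Lemma frobBl q (A A' B : 'M[K]_q) : frob (A - A') B = frob A B - frob A' B.
Proof. by rewrite /frob mulmxBl raddfB. Qed.

Lemma frobDl q (A A' B : 'M[K]_q) : frob (A + A') B = frob A B + frob A' B.
Proof. by rewrite /frob mulmxDl raddfD. Qed.

Lemma frobBr q (A B B' : 'M[K]_q) : frob A (B - B') = frob A B - frob A B'.
Proof. by rewrite !(frobC A) frobBl. Qed.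

Lemma frobZl q a (A B : 'M[K]_q) : frob (rscale a A) B = a * frob A B.
Proof. by rewrite /frob /rscale -scalemxAl -rtr_rscale. Qed.

Lemma frobZr q a (A B : 'M[K]_q) : frob A (rscale a B) = a * frob A B.
Proof. by rewrite !(frobC A) frobZl. Qed.

Lemma frob_suml q (I : Type) (s : seq I) (P : pred I) (A : I -> 'M[K]_q) B :
  frob (\sum_(i <- s | P i) A i) B = \sum_(i <- s | P i) frob (A i) B.
Proof. by rewrite /frob mulmx_suml raddf_sum. Qed.

Lemma frob_sumr q (I : Type) (s : seq I) (P : pred I) (A : I -> 'M[K]_q) B :
  frob B (\sum_(i <- s | P i) A i) = \sum_(i <- s | P i) frob B (A i).
Proof. by rewrite frobC frob_suml; under eq_bigr do rewrite frobC. Qed.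

Lemma frob_sa q (A B : 'M[K]_q) : selfadjoint B -> frob A B = rtr (A *m B).
Proof. by rewrite /frob => ->. Qed.

Lemma frob1l q (A : 'M[K]_q) : frob 1%:M A = rtr A.
Proof. by rewrite /frob mul1mx rtr_adjmx. Qed.

(** Used for definiteness of the norm and, for rank-one designs, to regroup the sum of |Pi_ik|^2 by
    matrix entries. *)
Lemma frob_norm2E q (A : 'M[K]_q) :
  frob_norm2 A = \sum_i \sum_j sRe (A i j * sconj (A i j)).
Proof.
rewrite /frob_norm2 /frob /rtr raddf_sum; apply: eq_bigr => i _ /=.
by rewrite mxE raddf_sum; apply: eq_bigr => j _; rewrite !mxE.
Qed.

Lemma frob_norm2_ge0 q (A : 'M[K]_q) : 0 <= frob_norm2 A.
Proof.
rewrite frob_norm2E; do 2!apply: sumr_ge0 => ? _; exact: sRe_normsq_ge0.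
Qed.

Lemma frob_norm2_eq0 q (A : 'M[K]_q) : frob_norm2 A = 0 -> A = 0.
Proof.
have ge0 (i j : 'I_q) : 0 <= sRe (A i j * sconj (A i j)).
  exact: sRe_normsq_ge0.
rewrite frob_norm2E => A0; apply/matrixP => i j; rewrite mxE.
have A0i : \sum_j sRe (A i j * sconj (A i j)) = 0.
  by apply: (psumr_eq0P _ A0) => // *; exact: sumr_ge0.
by apply/sRe_normsq_eq0/(psumr_eq0P _ A0i).
Qed.

End HilbertSchmidt.

(* In a rank factorization [A = C *m T] of an idempotent, cancellation gives
   [T *m C = 1%:M]. *)
Lemma mxtrace_idem (L : fieldType) q (A : 'M[L]_q) :
  A *m A = A -> \tr A = (\rank A)%:R.
Proof.
move=> AA; have TC : row_base A *m col_base A = 1%:M.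
  apply: (row_full_inj (col_base_full A)).
  apply: (row_free_inj (row_base_free A)).
  rewrite /= mulmx1 (mulmxA _ (row_base A)) mulmx_base.
  by rewrite -(mulmxA A) mulmx_base AA.
by rewrite -{1}(mulmx_base A) mxtrace_mulC TC mxtrace1.
Qed.

(** * Consecutive blocks of indices *)

Lemma card_ord_interval q a b : (a + b <= q)%N ->
  #|[pred l : 'I_q | a <= l < a + b]%N| = b.
Proof.
move=> abq; rewrite -sum1_card.
rewrite -(big_mkord (fun l => (a <= l < a + b)%N) (fun=> 1%N)).
under eq_bigl do rewrite andbC.
rewrite -(big_nat_widenl _ _ _ _ _ (leq0n a)).
rewrite -(big_nat_widen a _ _ xpredT) //.
by rewrite sum_nat_const_nat muln1 addKn.
Qed.

(** The blocks of lengths [w j] lie end to end. If the indices differed, the block of the smaller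
    one would end by the start of the other, and [l] could not lie in both. *)
Lemma eq_block_index m (w : 'I_m -> nat) (l : nat) (k k' : 'I_m) :
  (\sum_(j < m | (j < k)%N) w j <= l < \sum_(j < m | (j <= k)%N) w j)%N ->
  (\sum_(j < m | (j < k')%N) w j <= l < \sum_(j < m | (j <= k')%N) w j)%N ->
  k = k'.
Proof.
have mono (a b : 'I_m) : (a < b)%N ->
    (\sum_(j < m | (j <= a)%N) w j <= \sum_(j < m | (j < b)%N) w j)%N.
  move=> ab; rewrite [leqRHS](bigID (fun j : 'I_m => (j <= a)%N)) /=.
  rewrite [X in (_ <= X + _)%N](eq_bigl (fun j : 'I_m => (j <= a)%N)).
    exact: leq_addr.
  by move=> j; rewrite andb_idl // => /leq_ltn_trans; apply.
move=> /andP[lk kl] /andP[lk' kl'].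
apply: val_inj; case: (ltngtP k k') => // /mono h; exfalso;
  by move: lk kl lk' kl' h; lia.
Qed.

Lemma ex_block_index m (w : 'I_m -> nat) (l : nat) :
  (l < \sum_j w j)%N ->
  exists k : 'I_m,
    (\sum_(j < m | (j < k)%N) w j <= l < \sum_(j < m | (j <= k)%N) w j)%N.
Proof.
move=> lw; pose N t := (\sum_(j < m | (j < t)%N) w j)%N.
have exN : exists t, (l < N t)%N.
  by exists m; rewrite /N (eq_bigl xpredT) // => j; rewrite ltn_ord.
(* Take the least number of blocks that reaches beyond [l]; then [l] lies in the last of them, whose
   index is the predecessor [t]. *)
case: (ex_minnP exN) => -[|t] lN tmin.
  by move: lN; rewrite /N big_pred0.
have Nt : (N t <= l)%N by rewrite leqNgt; apply/negP => /tmin; rewrite ltnn.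
case: (ltnP t m) => tm; first by exists (Ordinal tm); rewrite Nt.
(* For [t >= m] there is no block [t], so both sums agree, although only the second one exceeds
   [l]. *)
suff : N t = N t.+1 by move: lN Nt; lia.
by apply: eq_bigl => j; have := ltn_ord j; lia.
Qed.

(** * Multiplicities and the index map *)

Section Design.
Context {R : realType} {F : base_field} {n q : nat}.
Local Notation K := (carrier R F).
Context {O : 'I_n -> 'M[K]_q}.
Variable sd : forall i, spectral_decomposition (O i).

(** An idempotent has trace equal to its rank. This turns the real multiplicities in [eigidx] into
    natural numbers, to which block counting applies. *)
Lemma mult_rank i (k : 'I_(neig (sd i))) : mult k = (\rank (eigproj k))%:R.
Proof.
rewrite /mult /rtr mxtrace_idem ?eigproj_idem//.
by rewrite -(rmorph_nat (@of_real R F)) sRe_of_real.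
Qed.

Lemma mult_gt0 i (k : 'I_(neig (sd i))) : 0 < mult k.
Proof. by rewrite mult_rank ltr0n lt0n mxrank_eq0 eigproj_neq0. Qed.

Lemma mult_neq0 i (k : 'I_(neig (sd i))) : mult k != 0.
Proof. by rewrite gt_eqF ?mult_gt0. Qed.

Lemma sum_rank_eigproj i :
  (\sum_(k < neig (sd i)) \rank (eigproj k) = q)%N.
Proof.
apply/eqP; rewrite -(eqr_nat R) natr_sum.
under eq_bigr do rewrite -mult_rank.
by rewrite -raddf_sum /= eigproj_sum rtr1.
Qed.

(** The ranks add up to [q], so every [l] lies in a block and the search in [eigidx] succeeds.
    Passing from [l.+1] to [l] moves the strict inequality from the lower to the upper bound. *)
Lemma eigidxP i (l : 'I_q) (k := eigidx sd i l) :
  (\sum_(j < neig (sd i) | (j < k)%N) \rank (eigproj j) <= l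
    < \sum_(j < neig (sd i) | (j <= k)%N) \rank (eigproj j))%N.
Proof.
have E (P : pred 'I_(neig (sd i))) :
    \sum_(j < neig (sd i) | P j) mult j
      = (\sum_(j < neig (sd i) | P j) \rank (eigproj j))%:R :> R.
  by rewrite natr_sum; apply: eq_bigr => j _; rewrite mult_rank.
rewrite {}/k /eigidx; case: pickP => [k|none] /=.
  by rewrite !E ltr_nat ler_nat ltnS.
have := ltn_ord l; rewrite -{2}(sum_rank_eigproj i) => /ex_block_index[k].
by have := none k; rewrite !E ltr_nat ler_nat ltnS => ->.
Qed.

(** By uniqueness of the block containing an index, the fibre of [eigidx] over [k] is exactly block
    [k], an interval. *)
Lemma card_eigidx i (k : 'I_(neig (sd i))) :
  #|[pred l | eigidx sd i l == k]| = \rank (eigproj k).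
Proof.
pose a := (\sum_(j < neig (sd i) | (j < k)%N) \rank (eigproj j))%N.
have kE : (\sum_(j < neig (sd i) | (j <= k)%N) \rank (eigproj j)
    = a + \rank (eigproj k))%N.
  rewrite (bigD1 k) //= addnC; congr (_ + _)%N; apply: eq_bigl => j.
  by rewrite ltn_neqAle andbC.
rewrite -[RHS](@card_ord_interval q a).
  apply: eq_card => l; rewrite !inE -kE; apply/eqP/idP => lk.
    by have := eigidxP i l; rewrite lk.
  exact: eq_block_index (eigidxP i l) lk.
rewrite -kE -[leqRHS](sum_rank_eigproj i).
by rewrite [leqRHS](bigID (fun j : 'I__ => (j <= k)%N)) leq_addr.
Qed.

Lemma sum_eigidx (V : nmodType) i (f : 'I_(neig (sd i)) -> V) :
  \sum_l f (eigidx sd i l) = \sum_k f k *+ \rank (eigproj k).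
Proof.
rewrite (partition_big (eigidx sd i) xpredT) //=; apply: eq_bigr => k _.
rewrite (eq_bigr (fun=> f k)) => [|l /eqP -> //].
by rewrite big_const card_eigidx iter_addr_0.
Qed.

End Design.

(** * The design tensor and its adjoint *)

Section LeastSquares.
Context {R : realType} {F : base_field} {n q : nat}.
Local Notation K := (carrier R F).
Context {O : 'I_n -> 'M[K]_q}.
Variable sd : forall i, spectral_decomposition (O i).

Lemma frob_eigproj i (k : 'I_(neig (sd i))) (S : 'M[K]_q) :
  frob (eigproj k) S = rtr (S *m eigproj k).
Proof. by rewrite frobC frob_sa //; exact: eigproj_sa. Qed.

(** The sum satisfies the adjoint identity because each entry of [design_tensor sd S] is, up to
    division by the multiplicity, an inner product with an eigenprojection. *)
Lemma design_adjointE A : design_adjoint sd A =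
  \sum_i \sum_l rscale (A i l / mult (eigidx sd i l)) (eigproj (eigidx sd i l)).
Proof.
set T0 := RHS; have T0P S : frob T0 S = rfrob A (design_tensor sd S).
  rewrite /T0 frob_suml; apply: eq_bigr => i _.
  rewrite frob_suml; apply: eq_bigr => l _.
  by rewrite frobZl frob_eigproj mxE -mulrA; congr (_ * _); rewrite mulrC.
have saT0 : selfadjoint T0 by do 2!apply: sa_sum => ?; exact/saZ/eigproj_sa.
rewrite /design_adjoint; apply: xget_unique => [|T [saT TP]]; first by split.
(* The difference of two solutions is self-adjoint, hence an admissible test matrix, and so
   orthogonal to itself. *)
apply/subr0_eq/frob_norm2_eq0; have saTT := saB saT saT0.
by rewrite /frob_norm2 frobBl TP // T0P subrr.
Qed.

Lemma design_adjoint_sa A : selfadjoint (design_adjoint sd A).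
Proof.
by rewrite design_adjointE; do 2!apply: sa_sum => ?; exact/saZ/eigproj_sa.
Qed.

Lemma frob_design_adjoint A S :
  frob (design_adjoint sd A) S = rfrob A (design_tensor sd S).
Proof.
rewrite design_adjointE frob_suml; apply: eq_bigr => i _.
rewrite frob_suml; apply: eq_bigr => l _.
by rewrite frobZl frob_eigproj mxE -mulrA; congr (_ * _); rewrite mulrC.
Qed.

Lemma design_adjointB A B :
  design_adjoint sd (A - B) = design_adjoint sd A - design_adjoint sd B.
Proof.
rewrite !design_adjointE -sumrB; apply: eq_bigr => i _; rewrite -sumrB.
by apply: eq_bigr => l _; rewrite !mxE mulrBl rscaleBl.
Qed.

Lemma design_tensorB S T :
  design_tensor sd (S - T) = design_tensor sd S - design_tensor sd T.
Proof. by apply/matrixP => i l; rewrite !mxE mulmxBl raddfB mulrBl. Qed.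

Lemma design_tensorZ c S :
  design_tensor sd (rscale c S) = c *: design_tensor sd S.
Proof.
by apply/matrixP => i l; rewrite !mxE /rscale -scalemxAl rtr_rscale mulrA.
Qed.

Lemma design_adjointZ c A :
  design_adjoint sd (c *: A) = rscale c (design_adjoint sd A).
Proof.
rewrite !design_adjointE raddf_sum; apply: eq_bigr => i _; rewrite raddf_sum.
by apply: eq_bigr => l _; rewrite !mxE /= rscalerA mulrA.
Qed.

(** Each [f i k] is divided by the multiplicity twice, once in the matrix entry and once by the
    adjoint; the number of columns that carry [k] cancels one division. Both D^*P and D^*D are
    instances. *)
Lemma design_adjoint_eigen (f : forall i, 'I_(neig (sd i)) -> R) :
  design_adjoint sd
    (\matrix_(i, l) (f i (eigidx sd i l) / mult (eigidx sd i l)))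
  = \sum_i \sum_k rscale (f i k / mult k) (eigproj k).
Proof.
rewrite design_adjointE; apply: eq_bigr => i _.
under eq_bigr do rewrite mxE.
rewrite (sum_eigidx (fun k => rscale (f i k / mult k / mult k) (eigproj k))).
apply: eq_bigr => k _; rewrite -rscale_nat rscalerA -mult_rank; congr rscale.
by rewrite mulrC divfK ?mult_neq0.
Qed.

Lemma design_adjoint_tensor S : design_adjoint sd (design_tensor sd S)
  = \sum_i \sum_k rscale (rtr (S *m eigproj k) / mult k)
                         (eigproj (k : 'I_(neig (sd i)))).
Proof. exact: (design_adjoint_eigen (fun i k => rtr (S *m eigproj k))). Qed.

(** The coefficients Tr[Pi_ik] / m_ik are 1, and the eigenprojections of each of the [n] observables
    sum to the identity. *)
Lemma design_adjoint_tensor1 :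
  design_adjoint sd (design_tensor sd 1%:M) = rscale n%:R 1%:M.
Proof.
rewrite design_adjoint_tensor rscale_nat -[in RHS](card_ord n) -sumr_const.
apply: eq_bigr => i _; rewrite -[RHS](eigproj_sum (sd i)).
apply: eq_bigr => k _.
by rewrite mul1mx divff ?mult_neq0 // rscale1.
Qed.

(** * The least-squares problem of a unitary design *)

Context {alpha : R}.
Hypotheses (q_ge2 : (1 < q)%N) (alpha_gt0 : 0 < alpha).
Hypothesis design : unitary_design sd alpha.

Lemma adjmx_delta (a b : 'I_q) :
  adjmx (delta_mx a b : 'M[K]_q) = delta_mx b a.
Proof.
by apply/matrixP => i j; rewrite !mxE rmorph_nat andbC.
Qed.


Lemma rtr_delta (a b : 'I_q) : rtr (delta_mx a b : 'M[K]_q) = (a == b)%:R.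
Proof.
rewrite /rtr /mxtrace (bigD1 a) //= big1 => [|i /negPf ia]; rewrite !mxE ?ia //.
by rewrite eqxx addr0 -(rmorph_nat (@of_real R F)) sRe_of_real.
Qed.

(** As [0^-1 = 0], the averaged operator would vanish for [n = 0], whereas it multiplies E_aa -
    E_bb, a nonzero traceless matrix available for [q >= 2], by [alpha > 0]. *)
Lemma design_size_gt0 : (0 < n)%N.
Proof.
rewrite lt0n; apply/eqP => n0.
pose a : 'I_q := Ordinal (ltnW q_ge2); pose b : 'I_q := Ordinal q_ge2.
pose E : 'M[K]_q := delta_mx a a - delta_mx b b.
have saE : selfadjoint E by apply: saB; exact: adjmx_delta.
have trE : \tr E = 0.
  by rewrite trace_sa // raddfB /= !rtr_delta !eqxx subrr rmorph0.
have /(congr1 (fun M : 'M[K]_q => sRe (M a a))) := design saE trE.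
rewrite {1}n0 invr0 rscale0 !mxE eqxx /= subr0 mulr1 raddf0 sRe_of_real.
by move/eqP; rewrite lt_eqF.
Qed.

Let q_neq0 : q%:R != 0 :> R.
Proof. by rewrite pnatr_eq0 -lt0n ltnW. Qed.

Let n_neq0 : n%:R != 0 :> R.
Proof. by rewrite pnatr_eq0 -lt0n design_size_gt0. Qed.

(** Split [S] into its traceless part [D] and [c] times the identity, on which D^*D acts as
    [n * alpha] and as [n]. *)
Lemma design_adjoint_tensor_sa S : selfadjoint S ->
  design_adjoint sd (design_tensor sd S)
    = rscale (n%:R * alpha) S + rscale (n%:R * (1 - alpha) * rtr S / q%:R) 1%:M.
Proof.
move=> saS; pose c := rtr S / q%:R; pose D := S - rscale c 1%:M.
have saD : selfadjoint D by apply/saB/saZ/sa1.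
have trD : \tr D = 0.
  by rewrite trace_sa // raddfB /= rtr_rscale rtr1 divfK // subrr rmorph0.
have /(congr1 (rscale n%:R)) := design saD trD.
rewrite !rscalerA divff // rscale1 /D design_tensorB design_adjointB.
rewrite design_tensorZ design_adjointZ design_adjoint_tensor1 rscalerA.
move/eqP; rewrite subr_eq => /eqP ->; rewrite raddfB /= rscalerA -addrA.
congr (_ + _); rewrite addrC -rscaleBl; congr rscale; rewrite /c; ring.
Qed.

Definition lse_closed_form A : 'M[K]_q :=
  rscale q%:R^-1 1%:M
  + rscale (n%:R * alpha)^-1
      (design_adjoint sd A - rscale (rtr (design_adjoint sd A) / q%:R) 1%:M).

Lemma lse_closed_form_sa A : selfadjoint (lse_closed_form A).
Proof.
apply: saD; first exact/saZ/sa1.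
by apply/saZ/saB; [exact: design_adjoint_sa|exact/saZ/sa1].
Qed.

Lemma rtr_lse_closed_form A : rtr (lse_closed_form A) = 1.
Proof.
rewrite /lse_closed_form raddfD /= !rtr_rscale raddfB /= !rtr_rscale rtr1.
by rewrite divfK // subrr mulr0 addr0 mulVf.
Qed.

(** First-order optimality under the trace constraint: D^* of the residual is a multiple of the
    identity, hence orthogonal to every traceless matrix. *)
Lemma frob_lse_residual A S : rtr S = 0 ->
  rfrob (design_tensor sd (lse_closed_form A) - A) (design_tensor sd S) = 0.
Proof.
move=> trS; rewrite -frob_design_adjoint design_adjointB.
rewrite design_adjoint_tensor_sa; last exact: lse_closed_form_sa.
rewrite {1}/lse_closed_form raddfD /= !rscalerA divff; last first.
  by rewrite mulf_neq0 // gt_eqF.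
set X := design_adjoint sd A.
rewrite rscale1 -!addrA [X in _ + X]addrC -!addrA addNr addr0.
(* [X] has cancelled; only multiples of the identity remain. *)
rewrite -rscaleN1 rscalerA addrCA -!rscaleDl frobZl frob1l trS mulr0 //.
Qed.

Lemma rfrobD2 (X Y : 'M[R]_(n, q)) :
  rfrob (X + Y) (X + Y) = rfrob X X + 2 * rfrob X Y + rfrob Y Y.
Proof.
rewrite /rfrob mulr_sumr -!big_split /=; apply: eq_bigr => i _.
rewrite mulr_sumr -!big_split /=; apply: eq_bigr => l _.
by rewrite !mxE; ring.
Qed.

(** Pythagoras: the image of the traceless step [S - S0] is orthogonal to the residual at [S0], and
    D^*D acts on that step as [n * alpha]. Positivity of this factor yields both minimality and
    uniqueness. *)
Lemma lse_error A S : selfadjoint S -> rtr S = 1 ->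
  rfrob (design_tensor sd S - A) (design_tensor sd S - A)
  = rfrob (design_tensor sd (lse_closed_form A) - A)
          (design_tensor sd (lse_closed_form A) - A)
    + n%:R * alpha * frob_norm2 (S - lse_closed_form A).
Proof.
move=> saS trS; set S0 := lse_closed_form A.
have saD : selfadjoint (S - S0) by apply: saB => //; exact: lse_closed_form_sa.
have trD : rtr (S - S0) = 0 by rewrite raddfB /= trS rtr_lse_closed_form subrr.
have -> : design_tensor sd S - A
    = (design_tensor sd S0 - A) + design_tensor sd (S - S0).
  by rewrite design_tensorB [RHS]addrC addrA subrK.
rewrite rfrobD2 frob_lse_residual // mulr0 addr0; congr (_ + _).
rewrite -frob_design_adjoint design_adjoint_tensor_sa // trD.
by rewrite mulr0 mul0r rscale0 addr0 frobZl.
Qed.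

Lemma lse_closed_formP A : is_lse sd A (lse_closed_form A).
Proof.
split; first exact: lse_closed_form_sa.
  rewrite trace_sa ?rtr_lse_closed_form ?rmorph1 //.
  exact: lse_closed_form_sa.
move=> T saT trT; rewrite (lse_error A saT).
  by rewrite lerDl !mulr_ge0 ?frob_norm2_ge0 // ltW.
by rewrite /rtr trT -(rmorph1 (@of_real R F)) sRe_of_real.
Qed.

Lemma is_lse_unique A S : is_lse sd A S -> S = lse_closed_form A.
Proof.
move=> [saS trS Smin]; apply/subr0_eq/frob_norm2_eq0/eqP.
have trS' : rtr S = 1 by rewrite /rtr trS -(rmorph1 (@of_real R F)) sRe_of_real.
have [sa0 tr0 _] := lse_closed_formP A.
have := Smin _ sa0 tr0; rewrite (lse_error A saS trS') gerDl.
have n_gt0 : 0 < n%:R :> R by rewrite ltr0n design_size_gt0.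
rewrite pmulr_rle0 ?mulr_gt0 // => le0.
by rewrite eq_le le0 frob_norm2_ge0.
Qed.

Lemma rho_lseE A : rho_lse sd A = lse_closed_form A.
Proof.
apply: xget_unique; first exact: lse_closed_formP.
by move=> S; exact: is_lse_unique.
Qed.

Lemma unique_lse A : unique (is_lse sd A) (rho_lse sd A).
Proof.
rewrite rho_lseE; split; first exact: lse_closed_formP.
by move=> S /is_lse_unique.
Qed.

(** * The estimator for genuine data *)

Section Data.
Context {r : nat}.
Hypothesis r_gt0 : (0 < r)%N.
Variable y : 'I_n -> 'I_r -> R.

Lemma design_adjoint_data : design_adjoint sd (data_matrix sd y)
  = \sum_i \sum_k rscale (freq y k / mult k) (eigproj (k : 'I_(neig (sd i)))).
Proof. exact: (design_adjoint_eigen (fun i k => freq y k)). Qed.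

Lemma sum_freq i : possible_data sd y ->
  \sum_(k < neig (sd i)) freq y k = 1.
Proof.
move=> yP; rewrite -mulr_suml -natr_sum.
under eq_bigr do rewrite -sum1dep_card big_mkcond /=.
rewrite exchange_big /= (eq_bigr (fun=> 1%N)) => [|j _].
  by rewrite sum1_card card_ord divff // pnatr_eq0 -lt0n.
(* Since the eigenvalues are distinct, outcome [j] is counted for this [k] only. *)
have [k ->] := yP i j; rewrite (bigD1 k) //= eqxx big1 // => k' k'k.
by rewrite (inj_eq (@eigval_inj _ _ _ _ (sd i))) eq_sym (negPf k'k).
Qed.

Lemma rtr_design_adjoint_data : possible_data sd y ->
  rtr (design_adjoint sd (data_matrix sd y)) = n%:R.
Proof.
move=> yP; rewrite design_adjoint_data raddf_sum /=.
rewrite -[n in n%:R]card_ord -sumr_const; apply: eq_bigr => i _.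
rewrite -(sum_freq i yP) raddf_sum; apply: eq_bigr => k _ /=.
by rewrite rtr_rscale divfK // mult_neq0.
Qed.

Lemma rho_lse_data : possible_data sd y ->
  rho_lse sd (data_matrix sd y)
  = rscale (n%:R * alpha)^-1 (design_adjoint sd (data_matrix sd y))
    - rscale ((1 - alpha) / alpha) (rscale q%:R^-1 1%:M).
Proof.
move=> yP; rewrite rho_lseE /lse_closed_form rtr_design_adjoint_data //.
rewrite raddfB /= addrCA -!rscaleN1 !rscalerA -rscaleDl; congr (_ + rscale _ _).
have a_neq0 : alpha != 0 by rewrite gt_eqF.
(* The coefficient of the identity: 1/q - n/(n alpha q) = -((1 - alpha)/alpha)/q. *)
by field; rewrite q_neq0 a_neq0 n_neq0.
Qed.

End Data.
End LeastSquares.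

(** * Rank-one designs: the value of [alpha] *)

Definition real_dim (F : base_field) : nat :=
  match F with RealField => 1 | ComplexField => 2 end.

(** The list is 1 over the reals and 1, i over the complex numbers, where Re(iz) = -Im z.
    Off-diagonal test matrices only see the real parts Re(uz), and these recover |z|^2. *)
Lemma ex_unit_basis (R : realType) (F : base_field) :
  exists us : seq (carrier R F),
    [/\ size us = real_dim F, forall u, u \in us -> sRe (u * sconj u) = 1
      & forall z, sRe (z * sconj z) = \sum_(u <- us) sRe (u * z) ^+ 2].
Proof.
case: F; [exists [:: 1] | exists [:: 1; 'i%C]]; split=> //.
- by move=> u; rewrite inE => /eqP ->; rewrite mul1r.
- by move=> z; rewrite big_seq1 mul1r.
- move=> u; rewrite !inE => /orP[]/eqP -> /=; ring.
- by move=> [x y]; rewrite !big_cons big_nil /=; ring.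
Qed.

Section RankOneDesign.
Context {R : realType} {F : base_field} {n q : nat}.
Local Notation K := (carrier R F).
Context {O : 'I_n -> 'M[K]_q}.
Variable sd : forall i, spectral_decomposition (O i).
Context {alpha : R}.
Hypotheses (q_ge2 : (1 < q)%N) (alpha_gt0 : 0 < alpha).
Hypothesis design : unitary_design sd alpha.
Hypothesis rank1 : forall i (k : 'I_(neig (sd i))), mult k = 1.

Let q_neq0 : q%:R != 0 :> R.
Proof. by rewrite pnatr_eq0 -lt0n ltnW. Qed.

Let n_neq0 : n%:R != 0 :> R.
Proof. by rewrite pnatr_eq0 -lt0n (design_size_gt0 q_ge2 alpha_gt0 design). Qed.

(** Both sides are the inner product of D^*D[S] with [S], computed once from the spectral formula
    with unit multiplicities and once from the design property. *)
Lemma sum_rtr_sq S : selfadjoint S ->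
  \sum_i \sum_(k < neig (sd i)) rtr (S *m eigproj k) ^+ 2
    = n%:R * alpha * frob_norm2 S + n%:R * (1 - alpha) * rtr S ^+ 2 / q%:R.
Proof.
move=> saS; transitivity (frob (design_adjoint sd (design_tensor sd S)) S).
  rewrite design_adjoint_tensor frob_suml; apply: eq_bigr => i _.
  rewrite frob_suml; apply: eq_bigr => k _.
  by rewrite frobZl frob_eigproj rank1 divr1.
rewrite (design_adjoint_tensor_sa q_ge2 alpha_gt0 design) //.
rewrite frobDl !frobZl frob1l; congr (_ + _); ring.
Qed.

Definition offdiag_test (a b : 'I_q) (u : K) : 'M[K]_q :=
  u *: delta_mx a b + sconj u *: delta_mx b a.

Lemma offdiag_test_sa a b u : selfadjoint (offdiag_test a b u).
Proof.
by rewrite /selfadjoint adjmxD !adjmxZ !adjmx_delta sconjK addrC.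
Qed.

Lemma trace_delta_mul (a b : 'I_q) (M : 'M[K]_q) :
  \tr (delta_mx a b *m M) = M b a.
Proof.
rewrite mxtrace_mulC /mxtrace (bigD1 b) //= big1 => [|i ib]; rewrite !mxE.
  rewrite addr0 (bigD1 a) //= big1 => [|j ja]; rewrite !mxE.
    by rewrite ?eqxx mulr1 addr0.
  by rewrite (negPf ja) mulr0.
by rewrite big1 // => j _; rewrite !mxE (negPf ib) andbF mulr0.
Qed.

Lemma sa_entry (M : 'M[K]_q) a b : selfadjoint M -> M a b = sconj (M b a).
Proof. by move=> saM; rewrite -[in LHS]saM !mxE. Qed.

Lemma rtr_offdiag_test a b u (M : 'M[K]_q) : selfadjoint M ->
  rtr (offdiag_test a b u *m M) = 2 * sRe (u * M b a).
Proof.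
move=> saM; rewrite /rtr mulmxDl -!scalemxAl mxtraceD !mxtraceZ.
rewrite !trace_delta_mul raddfD /= (sa_entry a b saM) -rmorphM sRe_conj; ring.
Qed.

Lemma sum_offdiag (a b : 'I_q) u : a != b ->
  \sum_i \sum_(k < neig (sd i)) sRe (u * eigproj k b a) ^+ 2
    = n%:R * alpha * sRe (u * sconj u) / 2.
Proof.
move=> ab; have := sum_rtr_sq (offdiag_test_sa a b u).
rewrite /frob_norm2 frob_sa; last exact: offdiag_test_sa.
rewrite rtr_offdiag_test; last exact: offdiag_test_sa.
(* The trace of the test matrix is its pairing with the identity, whose off-diagonal entry is 0. *)
rewrite -[X in rtr X ^+ 2]mulmx1 rtr_offdiag_test; last exact: sa1.
rewrite !mxE !eqxx [b == a]eq_sym (negPf ab) /= !mulr0 raddf0 mulr1 add0r.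
(* Each term of [h] is a square (2 Re)^2, hence the factor 4; the squared norm of the test matrix is
   2 |u|^2. *)
move=> h; apply: (mulfI (x := 4)); first by rewrite pnatr_eq0.
rewrite [RHS](_ : _ = n%:R * alpha * (2 * sRe (u * sconj u))); last by field.
rewrite mulr0 expr0n mulr0 mul0r addr0 in h; rewrite -h mulr_sumr.
apply: eq_bigr => i _; rewrite mulr_sumr; apply: eq_bigr => k _.
by rewrite rtr_offdiag_test ?exprMn; [ring|exact: eigproj_sa].
Qed.

Lemma sum_diag (a : 'I_q) :
  \sum_i \sum_(k < neig (sd i)) sRe (eigproj k a a * sconj (eigproj k a a))
    = n%:R * alpha + n%:R * (1 - alpha) / q%:R.
Proof.
have saE : selfadjoint (delta_mx a a : 'M[K]_q) by exact: adjmx_delta.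
have := sum_rtr_sq saE.
rewrite /frob_norm2 frob_sa // mul_delta_mx rtr_delta eqxx expr1n !mulr1 => <-.
apply: eq_bigr => i _; apply: eq_bigr => k _.
rewrite /rtr trace_delta_mul.
(* Diagonal entries are real, so the squared real part is the squared modulus. *)
have /esym/sconj_fixed -> := sa_entry a a (eigproj_sa k).
by rewrite sconj_of_real -rmorphM !sRe_of_real expr2.
Qed.

(** Each unit [u] contributes n alpha / 2, and there are [real_dim F] of them. *)
Lemma sum_offdiag_norm (a b : 'I_q) : a != b ->
  \sum_i \sum_(k < neig (sd i)) sRe (eigproj k a b * sconj (eigproj k a b))
    = n%:R * alpha * ((real_dim F)%:R / 2).
Proof.
move=> ab; have [us [<- us1 usE]] := ex_unit_basis R F.
transitivity (\sum_(u <- us) \sum_i \sum_(k < neig (sd i))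
    sRe (u * eigproj k a b) ^+ 2).
  rewrite exchange_big; apply: eq_bigr => i _.
  by rewrite exchange_big; apply: eq_bigr => k _; rewrite usE.
rewrite (eq_big_seq (fun=> n%:R * alpha / 2)) => [|u uus].
  rewrite big_const_seq count_predT iter_addr_0 -mulr_natr; ring.
by rewrite sum_offdiag 1?eq_sym // us1 // mulr1.
Qed.

Lemma alpha_rank1 : alpha = alphaQ R F q.
Proof.
pose N i (k : 'I_(neig (sd i))) a b :=
  sRe (eigproj k a b * sconj (eigproj k a b)).
(* The squared norm of a projection is its trace, and for each [i] these traces add up to Tr I =
   q. *)
have E1 : \sum_i \sum_(k < neig (sd i)) frob_norm2 (eigproj k) = n%:R * q%:R.
  rewrite mulr_natl -[in RHS](card_ord n) -sumr_const; apply: eq_bigr => i _.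
  rewrite -(rtr1 (F := F)) -(eigproj_sum (sd i)) raddf_sum.
  apply: eq_bigr => k _; rewrite /frob_norm2 frob_sa ?eigproj_idem //.
  exact: eigproj_sa.
have E2 : \sum_i \sum_(k < neig (sd i)) frob_norm2 (eigproj k)
    = \sum_a \sum_b \sum_i \sum_(k < neig (sd i)) N i k a b.
  under eq_bigr do under eq_bigr do rewrite frob_norm2E.
  under eq_bigr do rewrite exchange_big /=.
  rewrite exchange_big; apply: eq_bigr => a _.
  under eq_bigr do rewrite exchange_big /=.
  by rewrite exchange_big.
(* Each of the [q] rows has one diagonal and [q - 1] off-diagonal entries. *)
have E3 : n%:R * q%:R = q%:R * (n%:R * alpha + n%:R * (1 - alpha) / q%:R
    + (q%:R - 1) * (n%:R * alpha * ((real_dim F)%:R / 2))).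
  have sumq (x : R) : q%:R * x = \sum_(a < q) x.
    by rewrite sumr_const card_ord mulr_natl.
  rewrite -E1 E2 sumq.
  apply: eq_bigr => a _; rewrite (bigD1 a) //= sum_diag; congr (_ + _).
  rewrite (eq_bigr (fun=> n%:R * alpha * ((real_dim F)%:R / 2))) => [|b ba].
    by rewrite sumr_const cardC1 card_ord -[LHS]mulr_natl -subn1 natrB // ltnW.
  by rewrite sum_offdiag_norm // eq_sym.
have q1 : q%:R - 1 != 0 :> R by rewrite subr_eq0 pnatr_eq1 gtn_eqF.
(* Subtracting n from both sides of [E3] leaves the common factor n (q - 1), which is nonzero as
   [q >= 2]. *)
have E4 : alpha * (1 + q%:R * ((real_dim F)%:R / 2)) = 1.
  apply: (mulfI (mulf_neq0 n_neq0 q1)).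
  have -> : n%:R * (q%:R - 1) * 1 = n%:R * q%:R - n%:R :> R by ring.
  by rewrite E3; field.
have -> : alphaQ R F q = (1 + q%:R * ((real_dim F)%:R / 2))^-1.
  by case: (F) => /=; congr _^-1; field.
set c := 1 + _ in E4 *; rewrite -[RHS]mul1r -E4 mulfK //; apply/eqP => c0.
by move: E4; rewrite c0 mulr0 => /eqP; rewrite eq_sym oner_eq0.
Qed.

End RankOneDesign.

(** * Means of finite sums and covariances of events *)

Section Mean.
Context {d : measure_display} {Om : measurableType d} {R : realType}.
Variable Pr : probability Om R.

(** Integrability travels with the value, since additivity of the expectation requires it. *)
Definition has_mean (f : Om -> R) (v : R) : Prop :=
  f \in Lfun Pr 1 /\ ('E_Pr[f] = v%:E)%E.

Lemma has_mean_eq f g v : f =1 g -> has_mean f v -> has_mean g v.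
Proof. by move=> /funext ->. Qed.

Lemma has_meanD f g u v : has_mean f u -> has_mean g v ->
  has_mean (fun w => f w + g w) (u + v).
Proof.
move=> [Lf Ef] [Lg Eg]; split; first exact: rpredD.
by rewrite expectationD // Ef Eg.
Qed.

Lemma has_meanZ c f v : has_mean f v -> has_mean (fun w => c * f w) (c * v).
Proof.
move=> [Lf Ef].
have -> : (fun w => c * f w) = (c \o* f) by apply/funext => w /=; rewrite mulrC.
split; first exact: Lfun_scale.
by rewrite expectationZl // Ef.
Qed.

Lemma has_mean_cst c : has_mean (cst c) c.
Proof. by split; [exact: Lfun_cst|exact: expectation_cst]. Qed.

Lemma has_mean_sum (I : Type) (s : seq I) (P : pred I) f v :
  (forall i, has_mean (f i) (v i)) ->
  has_mean (fun w => \sum_(i <- s | P i) f i w) (\sum_(i <- s | P i) v i).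
Proof.
move=> H; elim: s => [|i s IH].
  rewrite big_nil; apply: has_mean_eq (has_mean_cst 0) => w.
  by rewrite big_nil.
rewrite big_cons; case: ifP => Pi.
  by apply: has_mean_eq (has_meanD (H i) IH) => w; rewrite big_cons Pi.
by apply: has_mean_eq IH => w; rewrite big_cons Pi.
Qed.

Lemma has_mean_indic (A : set Om) a :
  measurable A -> Pr A = a%:E -> has_mean \1_A a.
Proof.
move=> mA PA; split; last by rewrite expectation_indic.
by apply/Lfun1_integrable; exact: integrable_indic.
Qed.

(** The covariance of two events: the product expands into the indicator of the intersection, minus
    a 1_B, minus b 1_A, plus ab. *)
Lemma has_mean_centered_mul (A B : set Om) a b c :
  measurable A -> measurable B ->
  Pr A = a%:E -> Pr B = b%:E -> Pr (A `&` B) = c%:E ->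
  has_mean (fun w => (\1_A w - a) * (\1_B w - b)) (c - a * b).
Proof.
move=> mA mB PA PB PAB.
have hA := has_mean_indic mA PA; have hB := has_mean_indic mB PB.
have hAB := has_mean_indic (measurableI _ _ mA mB) PAB.
have := has_meanD (has_meanD hAB (has_meanZ (- a) hB))
  (has_meanD (has_meanZ (- b) hA) (has_mean_cst (a * b))).
rewrite (_ : c + - a * b + (- b * a + a * b) = c - a * b); last by ring.
by apply: has_mean_eq => w; rewrite indicI /=; ring.
Qed.

End Mean.

(** * The mean-squared error *)

Section MeanSquaredError.
Context {R : realType} {F : base_field} {n q r : nat}.
Local Notation K := (carrier R F).
Context {O : 'I_n -> 'M[K]_q}.
Variable sd : forall i, spectral_decomposition (O i).
Context {alpha : R}.
Hypotheses (q_ge2 : (1 < q)%N) (r_gt0 : (0 < r)%N) (alpha_gt0 : 0 < alpha).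
Hypothesis design : unitary_design sd alpha.
Hypothesis rank1 : forall i (k : 'I_(neig (sd i))), mult k = 1.
Variable rho : 'M[K]_q.
Hypotheses (rho_sa : selfadjoint rho) (rho_tr : \tr rho = 1).
Local Notation prob k := (rtr (rho *m eigproj k)).

Let q_neq0 : q%:R != 0 :> R.
Proof. by rewrite pnatr_eq0 -lt0n ltnW. Qed.

Let n_neq0 : n%:R != 0 :> R.
Proof. by rewrite pnatr_eq0 -lt0n (design_size_gt0 q_ge2 alpha_gt0 design). Qed.

Let r_neq0 : r%:R != 0 :> R.
Proof. by rewrite pnatr_eq0 -lt0n. Qed.

Let alpha_neq0 : alpha != 0.
Proof. by rewrite gt_eqF. Qed.

Let rtr_rho : rtr rho = 1.
Proof. by rewrite /rtr rho_tr -(rmorph1 (@of_real R F)) sRe_of_real. Qed.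

Lemma sum_prob i : \sum_(k < neig (sd i)) prob k = 1.
Proof.
by rewrite -raddf_sum /= -mulmx_sumr eigproj_sum mulmx1 rtr_rho.
Qed.

Lemma frob_eigproj_rank1 i (k l : 'I_(neig (sd i))) :
  frob (eigproj k) (eigproj l) = (k == l)%:R.
Proof.
rewrite frob_sa; last exact: eigproj_sa.
have [<-|kl] := eqVneq; first by rewrite eigproj_idem; exact: rank1.
by rewrite eigproj_orth // raddf0.
Qed.

(* [rho] fits its own expected data exactly, hence is the estimator there. *)
Lemma lse_closed_form_tensor :
  lse_closed_form sd (alpha := alpha) (design_tensor sd rho) = rho.
Proof.
apply/esym/(is_lse_unique q_ge2 alpha_gt0 design); split=> // T _ _.
rewrite subrr [leLHS]big1 => [|i _].
  by do 2!apply: sumr_ge0 => ? _; rewrite -expr2 sqr_ge0.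
by rewrite big1 // => l _; rewrite mxE mul0r.
Qed.

Section Outcomes.
Variable y : 'I_n -> 'I_r -> R.

Definition centered (p : 'I_n * 'I_r) (k : 'I_(neig (sd p.1))) : R :=
  (y p.1 p.2 == eigval k)%:R - prob k.

Lemma freq_sub_prob i (k : 'I_(neig (sd i))) :
  freq y k - prob k = r%:R^-1 * \sum_j centered (p := (i, j)) k.
Proof.
rewrite /centered sumrB /= sumr_const card_ord.
rewrite /freq -sum1dep_card big_mkcond /=.
by rewrite natr_sum -mulr_natl; field.
Qed.

(** Let [X] be the sum of the eigenprojections weighted by [centered]. The error is the traceless
    part of [X] times -1/(n alpha r), and that part has squared norm |X|^2 - (Tr X)^2 / q, whence
    the kernel with [- q%:R^-1]. *)
Lemma sqr_error :
  frob_norm2 (rho - rho_lse sd (data_matrix sd y))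
  = (n%:R * alpha * r%:R) ^- 2 *
    \sum_p \sum_p' \sum_k \sum_l
      (frob (eigproj k) (eigproj l) - q%:R^-1)
      * (centered (p := p) k * centered (p := p') l).
Proof.
pose X := \sum_(p : 'I_n * 'I_r) \sum_k
  rscale (centered (p := p) k) (eigproj k).
have DX : design_adjoint sd (data_matrix sd y)
    - design_adjoint sd (design_tensor sd rho) = rscale r%:R^-1 X.
  rewrite design_adjoint_data design_adjoint_tensor -sumrB.
  rewrite /X -(pair_bigA _ (fun i j =>
    \sum_k rscale (centered (p := (i, j)) k) (eigproj k))).
  rewrite raddf_sum; apply: eq_bigr => i _ /=.
  rewrite -sumrB exchange_big raddf_sum; apply: eq_bigr => k _ /=.
  by rewrite rank1 !divr1 -rscaleBl rscale_suml rscalerA freq_sub_prob.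
have trX : rtr X = \sum_(p : 'I_n * 'I_r) \sum_k centered (p := p) k.
  rewrite raddf_sum; apply: eq_bigr => p _; rewrite raddf_sum.
  by apply: eq_bigr => k _ /=; rewrite rtr_rscale [rtr _]rank1 mulr1.
have -> : rho - rho_lse sd (data_matrix sd y)
    = rscale (- (n%:R * alpha * r%:R)^-1) (X - rscale (rtr X / q%:R) 1%:M).
  (* Both [rho] and the estimate are values of the closed form, at D[rho] and at the data; the
     constant term I/q cancels in the difference. *)
  rewrite (rho_lseE q_ge2 alpha_gt0 design) -{1}lse_closed_form_tensor.
  rewrite /lse_closed_form opprD addrACA subrr add0r -raddfB /=.
  rewrite opprD addrACA -opprD -rscaleBl -mulrBl -raddfB.
  rewrite -(opprB (design_adjoint sd (data_matrix sd y))) DX.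
  rewrite -!rscaleN1 /= !rtr_rscale !raddfD /= !rscalerA.
  by congr (rscale _ _ + rscale _ _); field;
    rewrite ?q_neq0 ?n_neq0 ?r_neq0 ?alpha_neq0.
rewrite /frob_norm2 frobZl frobZr mulrA -expr2 sqrrN exprVn; congr (_ * _).
rewrite frobBl !frobBr !frobZl !frobZr (frobC X 1%:M) !frob1l rtr1.
rewrite [LHS](_ : _ = frob X X - q%:R^-1 * (rtr X * rtr X)); last by field.
rewrite {1}/X frob_suml trX mulr_suml mulr_sumr -sumrB; apply: eq_bigr => p _.
rewrite {1}/X frob_sumr mulr_sumr mulr_sumr -sumrB; apply: eq_bigr => p' _.
rewrite frob_suml mulr_suml mulr_sumr -sumrB; apply: eq_bigr => k _.
rewrite frob_sumr mulr_sumr mulr_sumr -sumrB; apply: eq_bigr => l _.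
by rewrite frobZl frobZr; ring.
Qed.

End Outcomes.

Context {d : measure_display} {Om : measurableType d}.
Context {Pr : probability Om R} {Y : 'I_n -> 'I_r -> {RV Pr >-> R}}.
Hypothesis law : outcomes sd rho Y.
Local Notation cent := (fun w => centered (fun i j => Y i j w)).

Let event (p : 'I_n * 'I_r) (k : 'I_(neig (sd p.1))) : set Om :=
  Y p.1 p.2 @^-1` [set eigval k].

Let measurable_event p k : measurable (@event p k).
Proof. exact: measurable_funPTI. Qed.

Let centeredE p k w : cent w p k = \1_(@event p k) w - prob k.
Proof.
rewrite /centered indicE; congr ((nat_of_bool _)%:R - _).
by apply/eqP/idP => [?|]; rewrite inE.
Qed.

(** The covariances of a single categorical outcome: for [k != l] the two events are disjoint, as
    [eigval] is injective. *)
Lemma mean_centered_same p (k l : 'I_(neig (sd p.1))) :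
  has_mean Pr (fun w => cent w p k * cent w p l)
    ((k == l)%:R * prob k - prob k * prob l).
Proof.
have [_ PY] := law.
apply: has_mean_eq (has_mean_centered_mul (@measurable_event p k)
  (@measurable_event p l) (PY _ _ _) (PY _ _ _) _).
  by move=> w; rewrite !centeredE.
have [<-|kl] := eqVneq; first by rewrite setIid mul1r PY.
rewrite mul0r (_ : _ `&` _ = set0) ?measure0 //.
apply/seteqP; split=> // w [Yk Yl].
by have /eigval_inj/eqP := etrans (esym Yk) Yl; rewrite (negPf kl).
Qed.

Lemma mean_centered_diff p p' k l : p != p' ->
  has_mean Pr (fun w => cent w p k * cent w p' l) 0.
Proof.
move=> pp'; have [ind PY] := law; rewrite -(subrr (prob k * prob l)).
apply: has_mean_eq (has_mean_centered_mul (@measurable_event p k)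
  (@measurable_event p' l) (PY _ _ _) (PY _ _ _) _).
  by move=> w; rewrite !centeredE.
(* Independence is applied to the subfamily of [p] and [p'], so only the values of [B] at these two
   indices matter. *)
pose B x : set R := if x == p then [set eigval k] else [set eigval l].
have mB x : measurable (B x) by rewrite /B; case: ifP.
have := ind [set p; p']%SET B mB.
rewrite big_setU1 ?inE // big_set1 /B eqxx eq_sym (negPf pp') !PY => h.
rewrite EFinM -h; congr (Pr _); apply/seteqP; split=> w /=.
  by move=> [wp wp'] x; rewrite !inE => /orP[]/eqP ->;
    rewrite ?eqxx // eq_sym (negPf pp').
move=> H; split; first by have := H p; rewrite !inE eqxx; apply.
by have := H p'; rewrite !inE eqxx orbT eq_sym (negPf pp'); apply.
Qed.

Lemma mean_sqr_error :
  has_mean Pr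
    (fun w =>
       frob_norm2 (rho - rho_lse sd (data_matrix sd (fun i j => Y i j w))))
    ((n%:R * r%:R * alpha ^+ 2)^-1
      * ((1 - q%:R^-1) - alpha * (rtr (rho *m rho) - q%:R^-1))).
Proof.
(* The contribution of one outcome, with probabilities p_k: summed against its covariances, the part
   [(k == l)] of the kernel gives the sum of p_k - p_k^2, and the part [q%:R^-1] gives 0 because all
   the covariances add up to 0. *)
pose v (p : 'I_n * 'I_r) := 1 - \sum_(k < neig (sd p.1)) prob k ^+ 2.
have mean_pair p p' : has_mean Pr (fun w => \sum_k \sum_l
      (frob (eigproj k) (eigproj l) - q%:R^-1) * (cent w p k * cent w p' l))
    (if p' == p then v p else 0).
  have [->|pp'] := eqVneq p' p; last first.
    rewrite [X in has_mean _ _ X](_ : _ =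
      \sum_(k < neig (sd p.1)) \sum_(l < neig (sd p'.1))
      (frob (eigproj k) (eigproj l) - q%:R^-1) * 0); last first.
      by rewrite big1 // => k _; rewrite big1 // => l _; rewrite mulr0.
    do 2!apply: has_mean_sum => ?; apply/has_meanZ/mean_centered_diff.
    by rewrite eq_sym.
  have -> : v p = \sum_(k < neig (sd p.1)) \sum_(l < neig (sd p.1))
      (frob (eigproj k) (eigproj l) - q%:R^-1)
      * ((k == l)%:R * prob k - prob k * prob l) :> R.
    rewrite /v -[X in X - _](sum_prob p.1) -sumrB; apply: eq_bigr => k _.
    (* In row [k] the remaining probabilities add up to 1 - p_k, so the terms in 1/q cancel and p_k
       - p_k^2 is left. *)
    have := sum_prob p.1; rewrite (bigD1 k) //= => /(canRL (addKr _)) sum_l.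
    rewrite (bigD1 k) //= frob_eigproj_rank1 eqxx.
    rewrite (eq_bigr (fun l => q%:R^-1 * prob k * prob l)) => [|l lk].
      by rewrite -mulr_sumr sum_l /=; ring.
    by rewrite frob_eigproj_rank1 eq_sym (negPf lk) /=; ring.
  by do 2!apply: has_mean_sum => ?; exact/has_meanZ/mean_centered_same.
have := has_meanZ ((n%:R * alpha * r%:R) ^- 2)
  (has_mean_sum (index_enum _) xpredT
    (fun p => has_mean_sum (index_enum _) xpredT (mean_pair p))).
rewrite [X in has_mean _ _ X -> _](_ : _ = (n%:R * r%:R * alpha ^+ 2)^-1
      * ((1 - q%:R^-1) - alpha * (rtr (rho *m rho) - q%:R^-1))).
  by apply: has_mean_eq => w; rewrite sqr_error.
under eq_bigr do rewrite -big_mkcond big_pred1_eq.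
rewrite -(pair_bigA _ (fun i j => v (i, j))) /=.
have sum_v i : \sum_j v (i, j)
    = r%:R * (1 - \sum_(k < neig (sd i)) prob k ^+ 2).
  by rewrite /v /= sumr_const card_ord mulr_natl.
under eq_bigr do rewrite sum_v.
rewrite -mulr_sumr sumrB sumr_const card_ord.
(* The squared probabilities add up to the quadratic form of D^*D at [rho]; this is where Tr[rho^2]
   enters. *)
rewrite (sum_rtr_sq q_ge2 alpha_gt0 design rank1 rho_sa) rtr_rho.
rewrite /frob_norm2 frob_sa //; field.
by rewrite ?q_neq0 ?n_neq0 ?r_neq0 ?alpha_neq0.
Qed.

End MeanSquaredError.

Theorem theorem4p14 (R : realType) (F : base_field) (n q r : nat)
    (hq : (2 <= q)%N) (hr : (0 < r)%N)
    (O : 'I_n -> 'M[carrier R F]_q) (hO : forall i, selfadjoint (O i))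
    (sd : forall i, spectral_decomposition (O i))
    (alpha : R) (halpha : 0 < alpha) (hdesign : unitary_design sd alpha) :
  (forall y : 'I_n -> 'I_r -> R, possible_data sd y ->
     let P := data_matrix sd y in
     [/\ design_adjoint sd P
           = \sum_(i < n) \sum_(k < neig (sd i))
               rscale (freq y k / mult k) (eigproj k),
         unique (is_lse sd P) (rho_lse sd P)
       & rho_lse sd P
           = rscale (n%:R * alpha)^-1 (design_adjoint sd P)
             - rscale ((1 - alpha) / alpha) (rscale q%:R^-1 1%:M)])
  /\
  ((forall (i : 'I_n) (k : 'I_(neig (sd i))), mult k = 1) ->
     alpha = alphaQ R F q
     /\
     (forall (rho : 'M[carrier R F]_q), density_matrix rho ->
      forall (d : measure_display) (Om : measurableType d)
        (Pr : probability Om R) (Y : 'I_n -> 'I_r -> {RV Pr >-> R}),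
        outcomes sd rho Y ->
        ('E_Pr[fun w =>
           frob_norm2 (rho - rho_lse sd (data_matrix sd (fun i j => Y i j w)))]
         = ((n%:R * r%:R * alphaQ R F q ^+ 2)^-1
            * ((1 - q%:R^-1)
               - alphaQ R F q * (rtr (rho *m rho) - q%:R^-1)))%:E)%E)).
Proof.
split=> [y yP P|rank1].
  split; [exact: design_adjoint_data|exact: (unique_lse hq halpha hdesign)|].
  exact: (rho_lse_data hq halpha hdesign).
have alphaE := alpha_rank1 hq halpha hdesign rank1.
split=> // rho [rho_sa _ rho_tr] d Om Pr Y law; rewrite -alphaE.
by case: (mean_sqr_error hq hr halpha hdesign rank1 rho_sa rho_tr law).
Qed.
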